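(* Let $c>0$ be an integer and let $t$ be a function of the input length $n$. Any language recognized by a Turing machine (with a read-only input tape holding $\rhd w \lhd$ and one read-write work tape) that, on every input of length $n$, uses at most $\lfloor \log(n+2)\rfloor$ work-tape cells, has a work tape alphabet of size at most $2^c$, and runs within $t(n)$ time, can also be recognized by a $(c+5)$-head finite automaton within $t(n)\cdot\left(\left(2c+\tfrac{3}{2}\right)n+2c+2\right)$ time.
   Context: Logarithms are base $2$. For an input string $w$ of length $n$, the input tape contains $\rhd w\lhd$, where $\rhd,\lhd$ are left and right end-markers not in the input alphabet. A $k$-head finite automaton is a finite-state machine with $k$ read-only heads on a tape containing $\rhd w\lhd$, all starting on the left end-marker; in each step, based on its current state and the $k$ symbols scanned by the heads, it changes state and moves each head independently one cell left, one cell right, or leaves it in place; it halts when it enters an accept or reject state or a head moves beyond an end-marker (the latter counting as rejection). It recognizes the set of strings it accepts. ''Within $T(n)$ time'' means the machine halts within $T(n)$ steps on every input of length $n$. *)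

(* Defs.v *)
From mathcomp Require Import all_boot.
Set Implicit Arguments. Unset Strict Implicit. Unset Printing Implicit Defensive.

(* Input tape: |> w <| , cells 0 .. n+1.                               *)
Inductive tsym (S : Type) := LEnd | Sym of S | REnd.
Arguments LEnd {S}. Arguments REnd {S}.

Definition tape_at (S : Type) (w : seq S) (p : nat) : tsym S :=
  if p == 0 then LEnd else
  match onth w p.-1 with Some a => Sym a | None => REnd end.

Inductive move := MLeft | MStay | MRight.

(* head move on the input tape of length n+2 (cells 0..n+1);
   None = the head moves beyond an end-marker *)
Definition move_in (n p : nat) (m : move) : option nat :=
  match m with
  | MLeft => if p is p'.+1 then Some p' else None
  | MStay => Some p
  | MRight => if p < n.+1 then Some p.+1 else None
  end.

Record MHFA (S : Type) (k : nat) := {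
  mh_st : finType;
  mh_start : mh_st;
  (* Some true = accept state, Some false = reject state, None = not halting *)
  mh_fin : mh_st -> option bool;
  mh_delta : mh_st -> {ffun 'I_k -> tsym S} -> mh_st * {ffun 'I_k -> move}
}.

Section MHFAsem.
Variables (S : Type) (k : nat) (A : MHFA S k) (w : seq S).

Inductive mh_cfg := MRun of mh_st A & {ffun 'I_k -> nat} | MFell.

Definition mh_step (c : mh_cfg) : mh_cfg :=
  match c with
  | MFell => MFell
  | MRun q h =>
    match mh_fin q with
    | Some _ => c
    | None =>
      let: (q', mv) := mh_delta q [ffun i => tape_at w (h i)] in
      if [forall i, move_in (size w) (h i) (mv i) != None]
      then MRun q' [ffun i => odflt 0 (move_in (size w) (h i) (mv i))]
      else MFell
    end
  end.

Definition mh_init : mh_cfg := MRun (mh_start A) [ffun _ => 0].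

Definition mh_run (m : nat) : mh_cfg := iter m mh_step mh_init.

Definition mh_halted (c : mh_cfg) : bool :=
  match c with MFell => true | MRun q _ => mh_fin q != None end.

Definition mh_accepting (c : mh_cfg) : bool :=
  match c with MFell => false | MRun q _ => mh_fin q == Some true end.

Definition mh_accepts : Prop := exists m, mh_accepting (mh_run m).

Definition mh_halts_within (T : nat) : Prop :=
  exists m, m <= T /\ mh_halted (mh_run m).
End MHFAsem.

Record TM (S : Type) := {
  tm_st : finType;
  tm_work : finType;
  tm_blank : tm_work;
  tm_start : tm_st;
  tm_fin : tm_st -> option bool;
  (* state, input symbol, work symbol |-> new state, written symbol,
     input head move, work head move *)
  tm_delta : tm_st -> tsym S -> tm_work -> tm_st * tm_work * move * move
}.

Section TMsem.
Variables (S : Type) (M : TM S) (w : seq S).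

(* state, input head position, work tape contents, work head position *)
Inductive tm_cfg := TRun of tm_st M & nat & (nat -> tm_work M) & nat | TFell.

(* work head: a left move on cell 0 leaves the head on cell 0 *)
Definition move_work (p : nat) (m : move) : nat :=
  match m with MLeft => p.-1 | MStay => p | MRight => p.+1 end.

Definition tm_step (c : tm_cfg) : tm_cfg :=
  match c with
  | TFell => TFell
  | TRun q ip tp wp =>
    match tm_fin q with
    | Some _ => c
    | None =>
      let: (q', g, mi, mw) := tm_delta q (tape_at w ip) (tp wp) in
      match move_in (size w) ip mi with
      | None => TFell
      | Some ip' => TRun q' ip' (fun j => if j == wp then g else tp j)
                         (move_work wp mw)
      end
    end
  end.

Definition tm_init : tm_cfg := TRun (tm_start M) 0 (fun _ => tm_blank M) 0.

Definition tm_run (m : nat) : tm_cfg := iter m tm_step tm_init.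

Definition tm_halted (c : tm_cfg) : bool :=
  match c with TFell => true | TRun q _ _ _ => tm_fin q != None end.

Definition tm_accepting (c : tm_cfg) : bool :=
  match c with TFell => false | TRun q _ _ _ => tm_fin q == Some true end.

Definition tm_accepts : Prop := exists m, tm_accepting (tm_run m).

Definition tm_halts_within (T : nat) : Prop :=
  exists m, m <= T /\ tm_halted (tm_run m).

Definition tm_space_within (s : nat) : Prop :=
  forall m, match tm_run m with TRun _ _ _ wp => (wp < s : Prop) | TFell => True end.
End TMsem.

(* Main.v *)
(** The symbol under the work head is kept in the finite control as [c] bits.
    The remaining cells form [c] binary tracks; with [s = trunc_log 2 (n + 2)],
    track [i] is a number below [2 ^ (s - 1)], stored as the position of a head.
    One more head P stores the work position [p] as [2 ^ p - 1].  Removing the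
    scanned cell makes a work-head move symmetric: going right (left) exchanges
    bit [p] (bit [p - 1]) of every track with the corresponding bit in the
    control.  Such an exchange takes two sweeps over the track, during which P
    and Q count modulo a power of two, plus one addition or subtraction, and P is
    doubled or halved once per move.  Two auxiliary heads Q and Y suffice, and
    all heads start at [0], which already encodes the blank tape, so there is no
    initialisation cost. *)

Require Import Defs.
From HB Require Import structures.
From mathcomp Require Import all_boot zify.

Set Implicit Arguments. Unset Strict Implicit. Unset Printing Implicit Defensive.

(** * Binary expansions and uniqueness of digits *)

Definition binval (f : nat -> bool) (n : nat) : nat := \sum_(j < n) f j * 2 ^ j.

Lemma binvalS f n : binval f n.+1 = binval f n + f n * 2 ^ n.
Proof. by rewrite /binval big_ord_recr. Qed.

Lemma binval_lt f n : binval f n < 2 ^ n.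
Proof.
elim: n => [|n IH]; first by rewrite /binval big_ord0.
by rewrite binvalS expnS; case: (f n); lia.
Qed.

(** The high part [m] is chosen before [g], so all sequences that differ from [f] at most in bit [k]
    share it, along with the low part. *)
Lemma binval_split f n k : k < n ->
  exists m, forall g, (forall j, j != k -> g j = f j) ->
    binval g n = m * (2 * 2 ^ k) + g k * 2 ^ k + binval f k.
Proof.
elim: n => // n IH; rewrite ltnS leq_eqVlt => /orP[/eqP<-|lt_kn].
  exists 0 => g gE; rewrite binvalS /binval.
  rewrite (eq_bigr (fun j : 'I_k => f j * 2 ^ j)); first by rewrite mul0n addnC.
  by move=> j _; rewrite gE // neq_ltn ltn_ord.
have [m mP] := IH lt_kn.
exists (m + f n * 2 ^ (n - k.+1)) => g gE.
rewrite binvalS mP // (gE n) ?gtn_eqF // mulnDl.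
have -> : 2 ^ n = 2 ^ (n - k.+1) * (2 * 2 ^ k) by rewrite -expnS -expnD subnK.
lia.
Qed.

Lemma digit_uniq q m1 m2 (b1 b2 : bool) r1 r2 : r1 < q -> r2 < q ->
  m1 * (2 * q) + b1 * q + r1 = m2 * (2 * q) + b2 * q + r2 ->
  [/\ m1 = m2, b1 = b2 & r1 = r2].
Proof.
move=> lt1 lt2 E.
have lt1' : b1 * q + r1 < 2 * q by case: (b1); lia.
have lt2' : b2 * q + r2 < 2 * q by case: (b2); lia.
have E' : edivn (m1 * (2 * q) + (b1 * q + r1)) (2 * q)
        = edivn (m2 * (2 * q) + (b2 * q + r2)) (2 * q) by congr edivn; lia.
move: E'; rewrite !edivn_eq // => -[-> E2].
by move: E2; case: (b1); case: (b2) => E2; split=> //; lia.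
Qed.

Section Encoding.
Variables (T : finType) (blank : T) (c : nat).
Hypothesis card_T : #|T| <= 2 ^ c.

Lemma exists_bit_encoding :
  exists e : T -> {ffun 'I_c -> bool}, injective e /\ e blank = [ffun=> false].
Proof.
have le_card : #|T| <= #|{ffun 'I_c -> bool}|.
  by rewrite card_ffun card_bool card_ord.
pose e0 (g : T) : {ffun 'I_c -> bool} :=
  enum_val (widen_ord le_card (enum_rank g)).
have e0_inj : injective e0.
  by move=> g1 g2 /enum_val_inj/(congr1 val)/= /val_inj/enum_rank_inj.
(* Translating modulo 2 by the code of the blank keeps injectivity and sends the blank to zero. *)
exists (fun g => [ffun i => e0 g i (+) e0 blank i]); split.
  move=> g1 g2 E; apply: e0_inj; apply/ffunP => i.
  have := congr1 (fun f : {ffun 'I_c -> bool} => f i) E; rewrite !ffunE.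
  exact: addIb.
by apply/ffunP => i; rewrite !ffunE addbb.
Qed.

End Encoding.

(* [Main] performs a step of the Turing machine; [Scan] moves a track into Y
   while reading a bit, [Back] moves it back, [Add] adds or subtracts the weight
   of that bit and [Ret] restores P; [Dup], [Undup] double P, and [Half0],
   [Half1], [Half2] halve it. *)
Inductive phase :=
  Main | Scan | Back | Add | Ret | Dup | Undup | Half0 | Half1 | Half2.

Definition phases :=
  [:: Main; Scan; Back; Add; Ret; Dup; Undup; Half0; Half1; Half2].

Definition phase_code (p : phase) : 'I_10 :=
  inord (match p with
  | Main => 0 | Scan => 1 | Back => 2 | Add => 3 | Ret => 4
  | Dup => 5 | Undup => 6 | Half0 => 7 | Half1 => 8 | Half2 => 9 end).

Definition phase_decode (i : 'I_10) : phase := nth Main phases i.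

Lemma phase_codeK : cancel phase_code phase_decode.
Proof. by case; rewrite /phase_decode inordK. Qed.

HB.instance Definition _ := Countable.copy phase (can_type phase_codeK).
HB.instance Definition _ : isFinite phase := CanIsFinite phase_codeK.

(** * The automaton and its transition table *)

Section Simulation.
Variables (S : finType) (c : nat) (M : TM S).
Local Notation nt := c.+1.
Local Notation bits := {ffun 'I_nt -> bool}.
Variable enc : tm_work M -> bits.
Hypothesis enc_inj : injective enc.

Definition dec (v : bits) : tm_work M :=
  odflt (tm_blank M) [pick g | enc g == v].

Lemma encK : cancel enc dec.
Proof.
move=> g; rewrite /dec; case: pickP => [g' /eqP/enc_inj //|/(_ g)].
by rewrite eqxx.
Qed.

Definition upd (T : Type) (f : {ffun 'I_nt -> T}) (i : 'I_nt) (a : T) :=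
  [ffun j => if j == i then a else f j].

Lemma upd_id T (f : {ffun 'I_nt -> T}) i : upd f i (f i) = f.
Proof. by apply/ffunP => j; rewrite ffunE; case: eqP => [->|]. Qed.

Definition state : Type := (tm_st M * bits * phase * bool * 'I_nt * bool)%type.

(* In a state [(q, v, ph, r, i, b)], [v] is the work symbol held in the
   control, [r] tells whether the work head goes right, [i] is the current
   track and [b] the bit read on it. *)
Definition next_track (q : tm_st M) (v : bits) (r : bool) (i : 'I_nt)
    (b : bool) : state :=
  let v' := upd v i b in
  if i == ord_max then (q, v', if r then Dup else Main, r, i, b)
  else (q, v', Scan, r, inord i.+1, false).

Definition moves : Type := (move * move * move * move * move)%type.

Definition no_move : moves := (MStay, MStay, MStay, MStay, MStay).

(* [zx], [zP], [zQ], [zY] tell whether the head of track [i] and the three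
   auxiliary heads scan the left end-marker; the moves are listed for track
   [i], the input head and the heads P, Q, Y. *)
Definition trans (st : state) (a : tsym S) (zx zP zQ zY : bool) :
    state * moves :=
  let: (q, v, ph, r, i, b) := st in
  match ph with
  | Main =>
    let: (q', g, mi, mw) := tm_delta q a (dec v) in
    let mv := (MStay, mi, MStay, MStay, MStay) in
    match mw with
    | MStay => ((q', enc g, Main, r, i, b), mv)
    | MRight => ((q', enc g, Scan, true, ord0, false), mv)
    | MLeft => if zP then ((q', enc g, Main, r, i, b), mv)
               else ((q', enc g, Half0, false, ord0, false), mv)
    end
  | Scan =>
    if zx then ((q, v, Back, r, i, b), no_move)
    else if (if b then zQ else zP) then
      ((q, v, Scan, r, i, ~~ b), (MLeft, MStay, MStay, MStay, MRight))
    else ((q, v, Scan, r, i, b),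
          if b then (MLeft, MStay, MRight, MLeft, MRight)
          else (MLeft, MStay, MLeft, MRight, MRight))
  | Back =>
    if zY then ((q, v, Add, r, i, b), no_move)
    else ((q, v, Back, r, i, b),
          if zQ then (MRight, MStay, MStay, MStay, MLeft)
          else (MRight, MStay, MRight, MLeft, MLeft))
  | Add =>
    if v i == b then (next_track q v r i b, no_move) else
    let mx := if v i then MRight else MLeft in
    if zP then ((q, v, Ret, r, i, b), (mx, MStay, MStay, MStay, MStay))
    else ((q, v, Add, r, i, b), (mx, MStay, MLeft, MRight, MStay))
  | Ret =>
    if zQ then (next_track q v r i b, no_move)
    else ((q, v, Ret, r, i, b), (MStay, MStay, MRight, MLeft, MStay))
  | Dup =>
    if zP then ((q, v, Undup, r, i, b), no_move)
    else ((q, v, Dup, r, i, b), (MStay, MStay, MLeft, MRight, MRight))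
  | Undup =>
    if ~~ zQ then
      ((q, v, Undup, r, i, b), (MStay, MStay, MRight, MLeft, MStay))
    else if ~~ zY then
      ((q, v, Undup, r, i, b), (MStay, MStay, MRight, MStay, MLeft))
    else ((q, v, Main, r, i, b), (MStay, MStay, MRight, MStay, MStay))
  | Half0 =>
    ((q, v, Half1, r, i, b), (MStay, MStay, MLeft, MStay, MStay))
  | Half1 =>
    if zP then ((q, v, Half2, r, i, b), no_move)
    else ((q, v, Half0, r, i, b), (MStay, MStay, MLeft, MRight, MStay))
  | Half2 =>
    if zQ then ((q, v, Scan, r, i, b), no_move)
    else ((q, v, Half2, r, i, b), (MStay, MStay, MRight, MLeft, MStay))
  end.

Arguments trans : simpl never.

(** The default [d] serves the last of the five non-track heads, since the lists in use have four
    entries: the input head, P, Q and Y. *)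
Definition pack (T : Type) (d : T) (f : 'I_nt -> T) (s : seq T) :
    {ffun 'I_(nt + 5) -> T} :=
  [ffun k => match split k with inl j => f j | inr j => nth d s j end].

Definition track (i : 'I_nt) : 'I_(nt + 5) := lshift 5 i.
Definition aux (j : 'I_5) : 'I_(nt + 5) := rshift nt j.

Lemma pack_track T (d : T) f s i : pack d f s (track i) = f i.
Proof. by rewrite ffunE (unsplitK (inl i)). Qed.

Lemma pack_aux T (d : T) f s j : pack d f s (aux j) = nth d s j.
Proof. by rewrite ffunE (unsplitK (inr j)). Qed.

Definition at_left (a : tsym S) : bool := if a is LEnd then true else false.

Lemma at_left_tape w p : at_left (tape_at w p) = (p == 0).
Proof. by rewrite /tape_at; case: eqP => // _; case: onth. Qed.

Definition delta (st : state) (rd : {ffun 'I_(nt + 5) -> tsym S}) :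
    state * {ffun 'I_(nt + 5) -> move} :=
  let: (q, v, ph, r, i, b) := st in
  let z j := at_left (rd (aux (inord j))) in
  let: (st', (mx, mi, mP, mQ, mY)) :=
    trans st (rd (aux ord0)) (at_left (rd (track i))) (z 1) (z 2) (z 3) in
  (st', pack MStay (fun j => if j == i then mx else MStay)
             [:: mi; mP; mQ; mY]).

(** Halting is tested only in [Main]: in the other phases [q] is already the next machine state,
    while the work-head move is still being carried out. *)
Definition fin (st : state) : option bool :=
  let: (q, v, ph, r, i, b) := st in if ph is Main then tm_fin q else None.

Definition automaton : MHFA S (nt + 5) :=
  {| mh_st := state;
     mh_start := (tm_start M, enc (tm_blank M), Main, false, ord0, false);
     mh_fin := fin; mh_delta := delta |}.

(** * Single steps and bounded reachability *)

Variable w : seq S.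
Local Notation n := (size w).
Local Notation step := (@mh_step S (nt + 5) automaton w).
Local Notation conf := (mh_cfg automaton).

Definition can (p : nat) (m : move) : bool :=
  match m with MLeft => 0 < p | MStay => true | MRight => p <= n end.

Lemma move_inE p m :
  move_in n p m = if can p m then Some (move_work p m) else None.
Proof. by case: m => //; case: p. Qed.

(* The head of track [i] is singled out: it is at position [a], whatever
   [x i] is. *)
Definition cfg (q : tm_st M) (v : bits) (ph : phase) (r : bool) (i : 'I_nt)
    (b : bool) (x : {ffun 'I_nt -> nat}) (a ip P Q Y : nat) : conf :=
  @MRun S (nt + 5) automaton (q, v, ph, r, i, b)
    (pack 0 (upd x i a) [:: ip; P; Q; Y]).

Lemma step_cfg q v ph r i b x a ip P Q Y st' mx mi mP mQ mY :
  fin (q, v, ph, r, i, b) = None ->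
  trans (q, v, ph, r, i, b) (tape_at w ip) (a == 0) (P == 0) (Q == 0) (Y == 0)
    = (st', (mx, mi, mP, mQ, mY)) ->
  step (cfg q v ph r i b x a ip P Q Y) =
  if [&& can a mx, can ip mi, can P mP, can Q mQ & can Y mY] then
    @MRun S (nt + 5) automaton st' (pack 0 (upd x i (move_work a mx))
      [:: move_work ip mi; move_work P mP; move_work Q mQ; move_work Y mY])
  else MFell automaton.
Proof.
move=> finE trE; rewrite /cfg /mh_step [mh_fin _]finE.
rewrite [mh_delta _]/=; set rd := [ffun k => _].
have rd_aux j : rd (aux j) = tape_at w (nth 0 [:: ip; P; Q; Y] j).
  by rewrite ffunE pack_aux.
have rd_track : rd (track i) = tape_at w a.
  by rewrite ffunE pack_track ffunE eqxx.
have -> : delta (q, v, ph, r, i, b) rd =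
    (st', pack MStay (fun j => if j == i then mx else MStay)
               [:: mi; mP; mQ; mY]).
  by rewrite /delta !rd_aux rd_track !at_left_tape !inordK //= trE.
rewrite {finE trE rd_aux rd_track}.
have packP T (d1 : T) (d2 : nat) (d3 : move) (g : nat -> move -> T) f1 s1 f2 s2 :
    size s1 = size s2 -> d1 = g d2 d3 ->
    [ffun k => g (pack d2 f1 s1 k) (pack d3 f2 s2 k)] =
    pack d1 (fun j => g (f1 j) (f2 j)) [seq g p.1 p.2 | p <- zip s1 s2].
  move=> szE ->; apply/ffunP => k; rewrite !ffunE; case: (split k) => // j.
  have [lt_j|ge_j] := ltnP j (size s1).
    by rewrite (nth_map (d2, d3)) ?size_zip -?szE ?minnn // nth_zip.
  by rewrite !nth_default // ?size_map ?size_zip -?szE ?minnn.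
set h := pack 0 _ _; set mv := pack MStay _ _.
have condE : [forall k, move_in n (h k) (mv k) != None] =
    [&& can a mx, can ip mi, can P mP, can Q mQ & can Y mY].
  have neqE p m : (move_in n p m != None) = can p m.
    by rewrite move_inE; case: can.
  apply/forallP/and5P => [ok|[okx oki okP okQ okY] k].
    split; first by have := ok (track i); rewrite neqE !pack_track ffunE eqxx.
    - by have := ok (aux (inord 0)); rewrite neqE !pack_aux inordK.
    - by have := ok (aux (inord 1)); rewrite neqE !pack_aux inordK.
    - by have := ok (aux (inord 2)); rewrite neqE !pack_aux inordK.
    - by have := ok (aux (inord 3)); rewrite neqE !pack_aux inordK.
  rewrite neqE /h /mv !ffunE; case: (split k) => [j|].
    by rewrite ffunE; case: eqP.
  by case=> -[|[|[|[|[|]]]]].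
rewrite condE; case: ifP => // /and5P[okx oki okP okQ okY].
congr MRun; rewrite (packP _ 0 0 MStay (fun p m => odflt 0 (move_in n p m))) //=.
rewrite !move_inE oki okP okQ okY /=.
apply/ffunP => k; rewrite !ffunE; case: (split k) => // j.
by rewrite !ffunE; case: eqP => //= _; rewrite move_inE okx.
Qed.

Definition reaches (k : nat) (C C' : conf) : Prop :=
  exists2 m, m <= k & iter m step C = C'.

Lemma reaches_refl C : reaches 0 C C.
Proof. by exists 0. Qed.

Lemma reaches_trans k1 k2 C1 C2 C3 :
  reaches k1 C1 C2 -> reaches k2 C2 C3 -> reaches (k1 + k2) C1 C3.
Proof.
move=> [m1 le1 <-] [m2 le2 <-]; exists (m2 + m1); last by rewrite iterD.
by rewrite addnC leq_add.
Qed.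

Lemma reaches_weaken k1 k2 C1 C2 :
  k1 <= k2 -> reaches k1 C1 C2 -> reaches k2 C1 C2.
Proof. by move=> le12 [m lem <-]; exists m => //; apply: leq_trans le12. Qed.

Lemma reaches_step k C C' : reaches k (step C) C' -> reaches k.+1 C C'.
Proof. by move=> [m lem <-]; exists m.+1; rewrite // iterSr. Qed.

Lemma cfg_step k q v ph r i b x a ip P Q Y st' mx mi mP mQ mY C :
  fin (q, v, ph, r, i, b) = None ->
  trans (q, v, ph, r, i, b) (tape_at w ip) (a == 0) (P == 0) (Q == 0) (Y == 0)
    = (st', (mx, mi, mP, mQ, mY)) ->
  [&& can a mx, can ip mi, can P mP, can Q mQ & can Y mY] ->
  reaches k (@MRun S (nt + 5) automaton st' (pack 0 (upd x i (move_work a mx))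
    [:: move_work ip mi; move_work P mP; move_work Q mQ; move_work Y mY])) C ->
  reaches k.+1 (cfg q v ph r i b x a ip P Q Y) C.
Proof.
by move=> finE trE ok reach; apply: reaches_step; rewrite (step_cfg _ finE trE) ok.
Qed.

Local Ltac cfg_step := eapply cfg_step; [reflexivity | reflexivity | | ].

(** * Loops of the individual phases *)

Section Loops.
Variables (q : tm_st M) (v : bits) (r : bool) (i : 'I_nt).
Variables (x : {ffun 'I_nt -> nat}) (ip : nat).

(* The heads P and Q, with [P + Q = d], shuttle with period [2 * d.+1] while
   Y counts the moves of the track head, so that the direction [b] of the
   shuttle is the quotient of Y by [d.+1] modulo 2. *)
Lemma scan_loop d a b P Q Y m : d <= n -> P + Q = d -> a + Y <= n.+1 ->
  Y = m * (2 * d.+1) + (if b then d.+1 + P else Q) ->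
  exists b' P' Q' m', [/\ P' + Q' = d,
    a + Y = m' * (2 * d.+1) + (if b' then d.+1 + P' else Q') &
    reaches a.+1 (cfg q v Scan r i b x a ip P Q Y)
                 (cfg q v Back r i b' x 0 ip P' Q' (a + Y))].
Proof.
move=> le_d; elim: a b P Q Y m => [|a IH] b P Q Y m dE le_Y YE.
  exists b, P, Q, m; split=> //.
  by cfg_step => //; apply: reaches_refl.
rewrite addSnnS; rewrite addSnnS in le_Y.
case: b YE => YE; [case: Q dE YE => [|Q] dE YE|case: P dE YE => [|P] dE YE].
(* A turn uses one track move without moving P or Q, so half a period has [d.+1] moves. Only the
   turn back to [false] completes a period and raises [m]. *)
- have [|b' [P' [Q' [m' [dE' aE' reach]]]]] := IH false P 0 Y.+1 m.+1 dE le_Y.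
    by lia.
  exists b', P', Q', m'; split=> //.
  by cfg_step => //; rewrite /= ; lia.
- have [||b' [P' [Q' [m' [dE' aE' reach]]]]] := IH true P.+1 Q Y.+1 m _ le_Y.
  + by lia.
  + by lia.
  exists b', P', Q', m'; split=> //.
  by cfg_step => //; rewrite /= ; lia.
- have [|b' [P' [Q' [m' [dE' aE' reach]]]]] := IH true 0 Q Y.+1 m dE le_Y.
    by lia.
  exists b', P', Q', m'; split=> //.
  by cfg_step => //; rewrite /= ; lia.
- have [||b' [P' [Q' [m' [dE' aE' reach]]]]] := IH false P Q.+1 Y.+1 m _ le_Y.
  + by lia.
  + by lia.
  exists b', P', Q', m'; split=> //.
  by cfg_step => //; rewrite /= ; lia.
Qed.

(** Since [Q <= Y], Q is emptied into P no later than Y reaches the left end, so one sweep restores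
    both the track and P. *)
Lemma back_loop b a P Q Y : Q <= Y -> a + Y <= n.+1 -> P + Q <= n.+1 ->
  reaches Y.+1 (cfg q v Back r i b x a ip P Q Y)
               (cfg q v Add r i b x (a + Y) ip (P + Q) 0 0).
Proof.
elim: Y a P Q => [|Y IH] a P Q le_Q le_Y le_P.
  have -> : Q = 0 by lia.
  rewrite !addn0.
  by cfg_step => //; apply: reaches_refl.
rewrite -addSnnS; case: Q le_Q le_P => [|Q] le_Q le_P.
  cfg_step; first by rewrite /=; lia.
  by apply: IH; rewrite /=; lia.
rewrite -[P + Q.+1]addSnnS.
cfg_step; first by rewrite /=; lia.
by apply: IH; rewrite /=; lia.
Qed.

(** The track head moves once more when P is found at [0], so [P = 2 ^ k - 1] yields a shift by
    [2 ^ k]. *)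
Lemma add_loop b a P Q : v i != b ->
  (if v i then a + P <= n else P < a) -> P + Q <= n.+1 ->
  reaches P.+1 (cfg q v Add r i b x a ip P Q 0)
    (cfg q v Ret r i b x (if v i then a + P.+1 else a - P.+1) ip 0 (P + Q) 0).
Proof.
move=> /negPf neq_b; elim: P a Q => [|P IH] a Q le_a le_P.
  apply: cfg_step; first by [].
  - by rewrite /trans neq_b.
  - by rewrite /=; case: (v i) le_a => /=; lia.
  - by rewrite addn1 subn1; case: (v i); apply: reaches_refl.
have trE : trans (q, v, Add, r, i, b) (tape_at w ip) (a == 0) false (Q == 0) true
  = ((q, v, Add, r, i, b),
     (if v i then MRight else MLeft, MStay, MLeft, MRight, MStay)).
  by rewrite /trans neq_b.
eapply cfg_step; [by [] | exact: trE | | ].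
  by rewrite /=; case: (v i) le_a => /=; lia.
have := IH (move_work a (if v i then MRight else MLeft)) Q.+1.
rewrite addnS; case: (v i) le_a => /= le_a; rewrite ?addSnnS ?subSS.
- by apply; lia.
- have -> : a.-1 - P.+1 = a - P.+2 by lia.
  by apply; lia.
Qed.

Lemma ret_loop b a P Q : P + Q <= n.+1 ->
  reaches Q.+1 (cfg q v Ret r i b x a ip P Q 0)
    (@MRun S (nt + 5) automaton (next_track q v r i b)
       (pack 0 (upd x i a) [:: ip; P + Q; 0; 0])).
Proof.
elim: Q P => [|Q IH] P le_P.
  rewrite [P + 0]addn0.
  by cfg_step => //; apply: reaches_refl.
rewrite -[P + Q.+1]addSnnS.
cfg_step; first by rewrite /=; lia.
by apply: IH; rewrite /=; lia.
Qed.

(** By uniqueness of digits the direction in which the scan ends is the bit [b] of the track. The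
    last bound makes the value with this bit set fit on the tape. The cost is two sweeps over the
    track, then [d.+1] steps each for [Add] and [Ret]. *)
Lemma exchange_track d m (b : bool) r0 : d <= n -> r0 <= d ->
  m * (2 * d.+1) + d.+1 + r0 <= n.+1 ->
  reaches (2 * (m * (2 * d.+1) + b * d.+1 + r0).+1 + 2 * d.+1)
    (cfg q v Scan r i false x (m * (2 * d.+1) + b * d.+1 + r0) ip d 0 0)
    (@MRun S (nt + 5) automaton (next_track q v r i b)
      (pack 0 (upd x i (m * (2 * d.+1) + v i * d.+1 + r0)) [:: ip; d; 0; 0])).
Proof.
move=> le_d le_r le_n; set a := m * (2 * d.+1) + b * d.+1 + r0.
have le_a : a + 0 <= n.+1 by rewrite /a; case: (b); lia.
have [||b' [P [Q [m' [dE aE reach]]]]] :=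
  @scan_loop d a false d 0 0 0 le_d _ le_a; rewrite ?addn0 //.
rewrite addn0 in aE reach.
have [mE bE rE] : [/\ m = m', b = b' & r0 = if b' then P else Q].
  apply: (@digit_uniq d.+1) => //; first by case: (b'); lia.
  by rewrite -/a aE; case: (b'); lia.
have {reach} := reaches_trans reach (@back_loop b' 0 P Q a _ _ _).
rewrite add0n dE -bE => reach.
have {}reach : reaches (2 * a.+1) (cfg q v Scan r i false x a ip d 0 0)
    (cfg q v Add r i b x a ip d 0 0).
  rewrite mul2n -addnn; apply: reach; last by lia.
    by rewrite aE; case: (b'); lia.
  by lia.
apply: (reaches_trans reach) => {reach}.
have [vb|neq_b] := eqVneq (v i) b.
  apply: (@reaches_weaken 1); first by lia.
  apply: (@cfg_step _ _ _ _ _ _ _ _ _ _ _ _ _ _ MStay MStay MStay MStay MStay).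
  - by [].
  - by rewrite /trans vb eqxx.
  - by [].
  - by rewrite /= vb; apply: reaches_refl.
have := reaches_trans (@add_loop b a d 0 neq_b _ _) (@ret_loop b _ 0 (d + 0) _).
rewrite addn0 add0n.
have -> : (if v i then a + d.+1 else a - d.+1)
  = m * (2 * d.+1) + v i * d.+1 + r0.
  by rewrite /a; case: (v i) neq_b; case: (b) => //= _; lia.
move=> reach; apply: reaches_weaken (reach _ _ _); try lia.
by rewrite /a; case: (v i) neq_b; case: (b) => //= _; lia.
Qed.

Lemma dup_loop b a P Q Y : P + Q <= n.+1 -> P + Y <= n.+1 ->
  reaches P.+1 (cfg q v Dup r i b x a ip P Q Y)
               (cfg q v Undup r i b x a ip 0 (P + Q) (P + Y)).
Proof.
elim: P Q Y => [|P IH] Q Y le_Q le_Y.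
  by cfg_step => //; apply: reaches_refl.
rewrite !addSnnS.
cfg_step; first by rewrite /=; lia.
by apply: IH; rewrite /=; lia.
Qed.

Lemma undup_loop b a P Q Y : P + Q + Y <= n ->
  reaches (Q + Y).+1 (cfg q v Undup r i b x a ip P Q Y)
               (cfg q v Main r i b x a ip (P + Q + Y).+1 0 0).
Proof.
elim: Q P => [|Q IH] P le_n.
  rewrite addn0 add0n; rewrite addn0 in le_n.
  elim: Y P le_n => [|Y IH] P le_n.
    rewrite addn0; cfg_step; first by rewrite /=; lia.
    exact: reaches_refl.
  rewrite -addSnnS.
  cfg_step; first by rewrite /=; lia.
  by apply: IH; rewrite /=; lia.
rewrite -addSnnS.
cfg_step; first by rewrite /=; lia.
by apply: IH; rewrite /=; lia.
Qed.

(** P is copied into both Q and Y, and the last step of [Undup] adds one: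
    [2 * (2 ^ p - 1) + 1 = 2 ^ p.+1 - 1]. *)
Lemma double b a P : 2 * P <= n ->
  reaches (3 * P + 2) (cfg q v Dup r i b x a ip P 0 0)
                      (cfg q v Main r i b x a ip (2 * P).+1 0 0).
Proof.
move=> le_P.
have := reaches_trans (@dup_loop b a P 0 0 _ _) (@undup_loop b a 0 _ _ _).
rewrite !addn0 add0n addnn -mul2n => reach.
by apply: reaches_weaken (reach _ _ _); lia.
Qed.

(** P is odd whenever [Half0] is entered, so its untested left move is always possible; Q counts the
    pairs removed. *)
Lemma half_loop b a k Q : k + Q <= n.+1 ->
  reaches (2 * k + 2) (cfg q v Half0 r i b x a ip (2 * k).+1 Q 0)
                      (cfg q v Half2 r i b x a ip 0 (k + Q) 0).
Proof.
elim: k Q => [|k IH] Q le_n.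
  cfg_step => //.
  by cfg_step => //; apply: reaches_refl.
rewrite mulnS [k.+1 + Q]addSnnS.
cfg_step => //.
cfg_step; first by rewrite /=; lia.
by apply: IH; rewrite /=; lia.
Qed.

Lemma unhalf_loop b a P Q : P + Q <= n.+1 ->
  reaches Q.+1 (cfg q v Half2 r i b x a ip P Q 0)
               (cfg q v Scan r i b x a ip (P + Q) 0 0).
Proof.
elim: Q P => [|Q IH] P le_P.
  rewrite addn0.
  by cfg_step => //; apply: reaches_refl.
rewrite -addSnnS.
cfg_step; first by rewrite /=; lia.
by apply: IH; rewrite /=; lia.
Qed.

Lemma halve b a k : k <= n ->
  reaches (3 * k + 3) (cfg q v Half0 r i b x a ip (2 * k).+1 0 0)
                      (cfg q v Scan r i b x a ip k 0 0).
Proof.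
move=> le_k.
have := reaches_trans (@half_loop b a k 0 _) (@unhalf_loop b a 0 (k + 0) _).
rewrite !addn0 add0n => reach.
by apply: reaches_weaken (reach _ _); lia.
Qed.

End Loops.

(** * Exchanging one bit of every track with the control *)

Lemma exchange_tracks q r ip d (m r0 : 'I_nt -> nat) (V B : bits) h :
  let val i (b : bool) := m i * (2 * d.+1) + b * d.+1 + r0 i in
  h <= n.+1 -> (forall i, r0 i <= d) ->
  (forall i, val i true < h) ->
  reaches (nt * (2 * h + 2 * d.+1))
    (cfg q V Scan r ord0 false [ffun i => val i (B i)] (val ord0 (B ord0))
         ip d 0 0)
    (cfg q B (if r then Dup else Main) r ord_max (B ord_max)
         [ffun i => val i (V i)] (val ord_max (V ord_max)) ip d 0 0).
Proof.
move=> val le_h le_r lt_h; set cost := 2 * h + _.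
(* Invariant after [k] tracks: the first [k] hold their bits of [V] and the control holds those of
   [B]; the others are untouched. *)
pose vk k : bits := [ffun j : 'I_nt => if j < k then B j else V j].
pose xk k : {ffun 'I_nt -> nat} :=
  [ffun j : 'I_nt => val j (if j < k then V j else B j)].
have track_k k : k < nt ->
    reaches cost (cfg q (vk k) Scan r (inord k) false (xk k) (xk k (inord k))
                      ip d 0 0)
      (@MRun S (nt + 5) automaton (next_track q (vk k) r (inord k) (B (inord k)))
         (pack 0 (xk k.+1) [:: ip; d; 0; 0])).
  move=> lt_k; set i : 'I_nt := inord k; have iE : i = k :> nat by rewrite inordK.
  have xkE : xk k i = val i (B i) by rewrite ffunE iE ltnn.
  have vkE : vk k i = V i by rewrite ffunE iE ltnn.
  have xkS : xk k.+1 = upd (xk k) i (val i (V i)).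
    apply/ffunP => j; rewrite !ffunE ltnS -{1 2}iE leq_eqVlt.
    by rewrite val_eqE; case: eqP => [->|].
  rewrite xkS xkE -vkE.
  have lt_i := lt_h i; have le_i := le_r i; rewrite /val mul1n in lt_i.
  apply: reaches_weaken (exchange_track _ _ _ _ _ _ _ _ _ _); try lia.
have reach_k k : k < nt ->
    reaches (k * cost) (cfg q V Scan r ord0 false [ffun i => val i (B i)]
                            (val ord0 (B ord0)) ip d 0 0)
      (cfg q (vk k) Scan r (inord k) false (xk k) (xk k (inord k)) ip d 0 0).
  elim: k => [|k IH] lt_k.
    have -> : inord 0 = ord0 :> 'I_nt by apply/val_inj; rewrite /= inordK.
    have -> : vk 0 = V by apply/ffunP => j; rewrite ffunE.
    have -> : xk 0 = [ffun i => val i (B i)] by apply/ffunP => j; rewrite !ffunE.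
    by rewrite ffunE; apply: reaches_refl.
  rewrite mulSnr; apply: reaches_trans (IH (ltnW lt_k)) _.
  have := track_k k (ltnW lt_k); rewrite /next_track.
  have iE : (inord k : 'I_nt) = k :> nat by rewrite inordK // ltnW.
  rewrite -val_eqE /= iE ltn_eqF //.
  have -> : upd (vk k) (inord k) (B (inord k)) = vk k.+1.
    apply/ffunP => j; rewrite !ffunE ltnS; case: eqVneq => [->|].
      by rewrite iE leqnn.
    by rewrite -val_eqE /= iE (leq_eqVlt j k) => /negPf->.
  by rewrite /cfg !upd_id.
rewrite mulSnr; apply: reaches_trans (reach_k c (ltnSn _)) _.
have := track_k c (ltnSn _); rewrite /next_track.
have -> : inord c = ord_max :> 'I_nt by apply/val_inj; rewrite /= inordK.
rewrite eqxx.
have -> : upd (vk c) ord_max (B ord_max) = B.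
  apply/ffunP => j; rewrite !ffunE; case: eqVneq => [->//|].
  by rewrite -val_eqE /= ltn_neqAle -ltnS ltn_ord => ->.
have -> : xk nt = [ffun i => val i (V i)].
  by apply/ffunP => j; rewrite !ffunE ltn_ord.
by rewrite /cfg -[val ord_max _](ffunE (fun i => val i (V i))) !upd_id.
Qed.

(* Each track records one bit of every work cell except the scanned one,
   hence one bit less than the number of available cells. *)
Definition nbits : nat := (trunc_log 2 (n + 2)).-1.

(** The increasing enumeration of all cells but [p]. Passing from [p] to [p.+1] changes it only at
    index [p], so a head move alters one bit per track. *)
Definition skip (p j : nat) : nat := if j < p then j else j.+1.

Definition track_val (tp : nat -> tm_work M) (p : nat) (i : 'I_nt) : nat :=
  binval (fun j => enc (tp (skip p j)) i) nbits.

Definition track_vals tp p : {ffun 'I_nt -> nat} := [ffun i => track_val tp p i].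

Lemma work_width : trunc_log 2 (n + 2) = nbits.+1.
Proof. by rewrite /nbits prednK // trunc_log_gt0; lia. Qed.

Lemma nbits_bound : 2 * 2 ^ nbits <= n + 2.
Proof. by rewrite -expnS -work_width; apply: trunc_logP; lia. Qed.

Lemma exchange_tape q r ip tp tp' p p' k : k < nbits ->
  (forall j, j != k -> tp' (skip p' j) = tp (skip p j)) ->
  exists b,
  reaches (nt * (2 * 2 ^ nbits + 2 * 2 ^ k))
    (cfg q (enc (tp' (skip p' k))) Scan r ord0 false
         (track_vals tp p) (track_vals tp p ord0) ip (2 ^ k).-1 0 0)
    (cfg q (enc (tp (skip p k))) (if r then Dup else Main) r ord_max b
         (track_vals tp' p') (track_vals tp' p' ord_max) ip (2 ^ k).-1 0 0).
Proof.
move=> lt_k tpE.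
set V := enc _; set B := enc (tp _).
pose f i j := enc (tp (skip p j)) i.
(* One family [m] of high parts serves both the old and the new tape, as they agree off index
   [k]. *)
have /fin_all_exists[m mP] : forall i : 'I_nt, exists m, forall g,
    (forall j, j != k -> g j = f i j) ->
    binval g nbits = m * (2 * 2 ^ k) + g k * 2 ^ k + binval (f i) k.
  by move=> i; apply: binval_split.
have powE : 2 ^ k = (2 ^ k).-1.+1 by rewrite prednK // expn_gt0.
have oldE : track_vals tp p = [ffun i =>
    m i * (2 * (2 ^ k).-1.+1) + B i * (2 ^ k).-1.+1 + binval (f i) k].
  by apply/ffunP => i; rewrite !ffunE -powE /track_val (mP i).
have newE : track_vals tp' p' = [ffun i =>
    m i * (2 * (2 ^ k).-1.+1) + V i * (2 ^ k).-1.+1 + binval (f i) k].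
  apply/ffunP => i; rewrite !ffunE -powE /track_val (mP i) // => j neq_jk.
  by rewrite /f tpE.
exists (B ord_max).
have bnd := nbits_bound.
have le_pow : 2 * 2 ^ k <= 2 ^ nbits by rewrite -expnS leq_exp2l.
have reach := @exchange_tracks q r ip (2 ^ k).-1 m (fun i => binval (f i) k)
  V B (2 ^ nbits).
rewrite -powE in reach.
rewrite oldE newE !ffunE -powE; apply: reach => [|i|i].
- by lia.
- by rewrite -ltnS -powE binval_lt.
(* Setting bit [k] gives another number of [nbits] bits, which bounds the track value whatever its
   actual bit. *)
- pose g j := if j == k then true else f i j.
  have gE j : j != k -> g j = f i j by rewrite /g => /negPf->.
  by have := binval_lt g nbits; rewrite (mP i g gE) /g eqxx.
Qed.

(** [r], [i] and [b] are leftovers of the previous move; no decision in [Main] depends on them, so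
    any values are allowed. *)
Definition simulates (C : tm_cfg M) (D : conf) : Prop :=
  match C with
  | TFell => D = MFell automaton
  | TRun q ip tp p => ip <= n.+1 /\ exists r i b,
      D = cfg q (enc (tp p)) Main r i b (track_vals tp p) (track_vals tp p i)
              ip (2 ^ p).-1 0 0
  end.

Definition in_space (C : tm_cfg M) : Prop :=
  match C with TRun _ _ _ p => p <= nbits | TFell => True end.

(** The time allowed per machine step, doubled to clear the fraction 3/2; [nt] is the number of
    tracks. *)
Definition double_cost : nat := (4 * nt + 3) * n + 4 * nt + 4.

(** Used with [h = 2 ^ nbits] and [q = 2 ^ p]; the successor of [k] pays for the [Main] step. From
    [1 < h] one gets [n >= 2], whence [3 * h <= 2 * n + 2]. *)
Lemma cost_bound k h q : 1 < h -> 2 * q <= h -> 2 * h <= n + 2 ->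
  k <= nt * (2 * h + 2 * q) + 3 * q -> 2 * k.+1 <= double_cost.
Proof.
move=> h_gt1 le_q le_h le_k; rewrite /double_cost.
have le_nt : nt * (2 * h + 2 * q) <= nt * (3 * h) by rewrite leq_mul2l; lia.
have le_nt2 : nt * (3 * h) <= nt * (2 * n + 2) by rewrite leq_mul2l; lia.
have E : (4 * nt + 3) * n + 4 * nt + 4 = 2 * (nt * (2 * n + 2)) + 3 * n + 4.
  by rewrite mulnDr mulnDl; lia.
rewrite E; lia.
Qed.

(** * Simulating one step of the Turing machine *)

Lemma main_step q ip tp p r i b q' g mi mw : tm_fin q = None ->
  tm_delta q (tape_at w ip) (tp p) = (q', g, mi, mw) ->
  let x := track_vals tp p in let P := (2 ^ p).-1 in
  step (cfg q (enc (tp p)) Main r i b x (x i) ip P 0 0) =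
  if can ip mi then
    @MRun S (nt + 5) automaton
      (match mw with
       | MStay => (q', enc g, Main, r, i, b)
       | MRight => (q', enc g, Scan, true, ord0, false)
       | MLeft => if P == 0 then (q', enc g, Main, r, i, b)
                  else (q', enc g, Half0, false, ord0, false)
       end) (pack 0 x [:: move_work ip mi; P; 0; 0])
  else MFell automaton.
Proof.
move=> finE deltaE x P; set st' := (X in MRun X).
have trE : trans (q, enc (tp p), Main, r, i, b) (tape_at w ip) (x i == 0)
    (P == 0) (0 == 0) (0 == 0) = (st', (MStay, mi, MStay, MStay, MStay)).
  by rewrite /trans encK deltaE /st'; case: (mw) => //; case: (P == 0).
rewrite (@step_cfg q (enc (tp p)) Main r i b x (x i) ip P 0 0 _ _ _ _ _ _ _ trE) //.
by rewrite /= !andbT upd_id.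
Qed.

Lemma track_vals_off tp tp' p : (forall j, j != p -> tp' j = tp j) ->
  track_vals tp' p = track_vals tp p.
Proof.
move=> tpE; apply/ffunP => i; rewrite !ffunE; apply: eq_bigr => j _.
by rewrite tpE // /skip; case: ltnP; lia.
Qed.

(** The exchange of bit [p] needs P at [2 ^ p - 1], so it precedes the doubling. The control hands
    over the symbol just written on cell [p] and receives that of cell [p.+1]. *)
Lemma move_right q ip tp tp' p : p < nbits ->
  (forall j, j != p -> tp' j = tp j) ->
  exists k b, 2 * k.+1 <= double_cost /\
  reaches k
    (cfg q (enc (tp' p)) Scan true ord0 false
         (track_vals tp p) (track_vals tp p ord0) ip (2 ^ p).-1 0 0)
    (cfg q (enc (tp' p.+1)) Main true ord_max b (track_vals tp' p.+1)
         (track_vals tp' p.+1 ord_max) ip (2 ^ p.+1).-1 0 0).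
Proof.
move=> lt_p tpE.
have [|b reach] := @exchange_tape q true ip tp tp' p p.+1 p lt_p.
  move=> j neq; rewrite tpE; last by rewrite /skip; case: ltnP; lia.
  by congr tp; rewrite /skip; case: (ltnP j p); case: (ltnP j p.+1); lia.
have skipE : skip p p = p.+1 by rewrite /skip ltnn.
have skipE' : skip p.+1 p = p by rewrite /skip ltnSn.
rewrite skipE skipE' -(tpE p.+1) in reach; last by rewrite gtn_eqF.
have pow_gt0 : 0 < 2 ^ p by rewrite expn_gt0.
have le_pow : 2 * 2 ^ p <= 2 ^ nbits by rewrite -expnS leq_exp2l.
have bnd := nbits_bound.
have powE : (2 ^ p.+1).-1 = (2 * (2 ^ p).-1).+1 by rewrite expnS; lia.
rewrite powE; eexists; exists b; split; last first.
  by apply: (reaches_trans reach); apply: double; lia.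
by apply: (@cost_bound _ (2 ^ nbits) (2 ^ p)); lia.
Qed.

(** Here P is halved first, to bring it to [2 ^ p - 1] before the exchange. *)
Lemma move_left q ip tp tp' p : p < nbits ->
  (forall j, j != p.+1 -> tp' j = tp j) ->
  exists k b, 2 * k.+1 <= double_cost /\
  reaches k
    (cfg q (enc (tp' p.+1)) Half0 false ord0 false
         (track_vals tp p.+1) (track_vals tp p.+1 ord0) ip (2 ^ p.+1).-1 0 0)
    (cfg q (enc (tp' p)) Main false ord_max b (track_vals tp' p)
         (track_vals tp' p ord_max) ip (2 ^ p).-1 0 0).
Proof.
move=> lt_p tpE.
have [|b reach] := @exchange_tape q false ip tp tp' p.+1 p p lt_p.
  move=> j neq; rewrite tpE; last by rewrite /skip; case: ltnP; lia.
  by congr tp; rewrite /skip; case: (ltnP j p); case: (ltnP j p.+1); lia.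
have skipE : skip p p = p.+1 by rewrite /skip ltnn.
have skipE' : skip p.+1 p = p by rewrite /skip ltnSn.
rewrite skipE skipE' -(tpE p) in reach; last by rewrite ltn_eqF.
have pow_gt0 : 0 < 2 ^ p by rewrite expn_gt0.
have le_pow : 2 * 2 ^ p <= 2 ^ nbits by rewrite -expnS leq_exp2l.
have bnd := nbits_bound.
have powE : (2 ^ p.+1).-1 = (2 * (2 ^ p).-1).+1 by rewrite expnS; lia.
rewrite powE; eexists; exists b; split; last first.
  by apply: reaches_trans reach; apply: halve; lia.
by apply: (@cost_bound _ (2 ^ nbits) (2 ^ p)); lia.
Qed.

Lemma simulates_step C D : simulates C D -> in_space C ->
  in_space (tm_step w C) ->
  exists k D', [/\ 2 * k <= double_cost, simulates (tm_step w C) D'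
                 & reaches k D D'].
Proof.
have cost1 : 2 * 1 <= double_cost by rewrite /double_cost; lia.
case: C => [q ip tp p|] /=; last first.
  by move=> -> _ _; exists 0, (MFell automaton); split=> //; apply: reaches_refl.
case finE: (tm_fin q) => [e|] [le_ip [r [i [b ->]]]] le_p.
  move=> _; exists 0; eexists; split; [by []| |exact: reaches_refl].
  by split=> //; exists r, i, b.
case deltaE: (tm_delta q _ _) => [[[q' g] mi] mw].
have := main_step r i b finE deltaE; cbv zeta; rewrite move_inE.
case: ifP => [can_mi|_] stepE; last first.
  by move=> _; exists 1, (MFell automaton); split=> //; exists 1.
set ip' := move_work ip mi in stepE *; set tp' := fun j => _.
have le_ip' : ip' <= n.+1.
  by move: can_mi; rewrite /ip'; case: (mi) => /=; lia.
have tp'p : tp' p = g by rewrite /tp' eqxx.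
have tp'E j : j != p -> tp' j = tp j by rewrite /tp' => /negPf->.
(* This also covers a left move on cell [0], which the automaton recognizes by [2 ^ p - 1 = 0]. *)
have stay : exists k D', [/\ 2 * k.+1 <= double_cost,
    simulates (TRun q' ip' tp' p) D' &
    reaches k (@MRun S (nt + 5) automaton (q', enc g, Main, r, i, b)
                (pack 0 (track_vals tp p) [:: ip'; (2 ^ p).-1; 0; 0])) D'].
  exists 0; eexists; split; [by []| |exact: reaches_refl].
  split=> //; exists r, i, b.
  by rewrite tp'p (track_vals_off tp'E) /cfg upd_id.
clearbody tp'; case: mw {deltaE} stepE => stepE le_p'.
- case: p => [|p] in le_p le_p' tp'p tp'E stay stepE *.
    have [k [D' [le_k simD reach]]] := stay.
    by exists k.+1, D'; split=> //; apply: reaches_step; rewrite stepE.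
  have [k [b' [le_k]]] := move_left q' ip' le_p tp'E.
  rewrite tp'p /cfg upd_id => reach.
  exists k.+1; eexists; split; [exact: le_k| |].
    by split; [exact: le_ip'|exists false, ord_max, b'].
  apply: reaches_step; rewrite stepE ifF; first exact: reach.
  by have := expn_gt0 2 p; rewrite expnS; lia.
- have [k [D' [le_k simD reach]]] := stay.
  by exists k.+1, D'; split=> //; apply: reaches_step; rewrite stepE.
- have [k [b' [le_k]]] := move_right q' ip' le_p' tp'E.
  rewrite tp'p /cfg upd_id => reach.
  exists k.+1; eexists; split; [exact: le_k| |].
    by split; [exact: le_ip'|exists true, ord_max, b'].
  by apply: reaches_step; rewrite stepE.
Qed.

(** * Whole runs: time and acceptance *)

Hypothesis enc_blank : enc (tm_blank M) = [ffun=> false].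

Lemma simulates_init : simulates (tm_init M) (mh_init automaton).
Proof.
split=> //; exists false, ord0, false; rewrite /cfg upd_id.
congr MRun; apply/ffunP => k; rewrite !ffunE; case: (split k) => [j|].
  by rewrite ffunE /track_val /binval big1 // => l _; rewrite enc_blank ffunE.
by case=> -[|[|[|[|[|]]]]].
Qed.

Hypothesis space : tm_space_within M w (trunc_log 2 (n + 2)).

Lemma run_in_space m : in_space (tm_run M w m).
Proof.
by have := space m; case: tm_run => //= _ _ _ p; rewrite work_width.
Qed.

Lemma simulates_run m : exists k D, [/\ 2 * k <= m * double_cost,
  simulates (tm_run M w m) D & reaches k (mh_init automaton) D].
Proof.
elim: m => [|m [k [D [le_k simD reach]]]].
  exists 0, (mh_init automaton); split=> //; last exact: reaches_refl.
  exact: simulates_init.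
have [k' [D' [le_k' simD' reach']]] :=
  simulates_step simD (run_in_space m) (run_in_space m.+1).
exists (k + k'), D'; split=> //; last exact: reaches_trans reach'.
by rewrite mulnDr [m.+1 * _]mulSnr leq_add.
Qed.

Lemma simulates_halted C D : simulates C D -> mh_halted D = tm_halted C.
Proof. by case: C => [q ip tp p [_ [r [i [b ->]]]]|->]. Qed.

Lemma simulates_accepting C D : simulates C D -> mh_accepting D = tm_accepting C.
Proof. by case: C => [q ip tp p [_ [r [i [b ->]]]]|->]. Qed.

Lemma automaton_halts_within t : tm_halts_within M w t ->
  mh_halts_within automaton w (t * double_cost %/ 2).
Proof.
move=> [m [le_m haltM]].
have [k [D [le_k simD [j le_j jE]]]] := simulates_run m.
exists j; split; last by rewrite /mh_run jE (simulates_halted simD).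
rewrite leq_divRL // mulnC; apply: leq_trans (leq_mul le_m (leqnn _)).
by apply: leq_trans le_k; rewrite leq_mul2l le_j.
Qed.

Lemma tm_accepts_mh_accepts : tm_accepts M w -> mh_accepts automaton w.
Proof.
move=> [m accM].
have [k [D [_ simD [j _ jE]]]] := simulates_run m.
by exists j; rewrite /mh_run jE (simulates_accepting simD).
Qed.

Lemma mh_halted_run j l : mh_halted (mh_run automaton w j) -> j <= l ->
  mh_run automaton w l = mh_run automaton w j.
Proof.
move=> halted /subnK <-; rewrite {1}/mh_run iterD -/(mh_run automaton w j).
elim: (l - j) => //= d ->; move: halted.
by case: mh_run => //= st h; case: fin.
Qed.

Lemma mh_accepting_halted D : mh_accepting (A := automaton) D -> mh_halted D.
Proof. by case: D => //= st h /eqP->. Qed.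

(** The accepting time [l] need not be one at which the simulation relates the two runs. Since the
    machine halts, the automaton is halted at a related time [j]; halted configurations are fixed,
    so those at [j] and [l] coincide. *)
Lemma mh_accepts_tm_accepts t : tm_halts_within M w t ->
  mh_accepts automaton w -> tm_accepts M w.
Proof.
move=> [m [_ haltM]] [l accA].
have [k [D [_ simD [j _ jE]]]] := simulates_run m.
have haltD : mh_halted (mh_run automaton w j).
  by rewrite /mh_run jE (simulates_halted simD).
exists m; rewrite -(simulates_accepting simD) -jE -/(mh_run automaton w j).
have [le_jl|lt_lj] := leqP j l; first by rewrite -(mh_halted_run haltD le_jl).
by rewrite (mh_halted_run (mh_accepting_halted accA) (ltnW lt_lj)).
Qed.

End Simulation.

(* floor(log2(n+2)) = trunc_log 2 (n+2).
   Time bound t(n)*((2c+3/2)n+2c+2) on a natural number of steps m is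
   equivalent to m <= floor(t(n)*((4c+3)n+4c+4)/2). *)
Theorem theorem1 (S : finType) (c : nat) (t : nat -> nat)
    (L : seq S -> Prop) (M : TM S) :
  0 < c ->
  #|tm_work M| <= 2 ^ c ->
  (forall w : seq S, tm_space_within M w (trunc_log 2 (size w + 2))) ->
  (forall w : seq S, tm_halts_within M w (t (size w))) ->
  (forall w : seq S, L w <-> tm_accepts M w) ->
  exists A : MHFA S (c + 5),
    (forall w : seq S, L w <-> mh_accepts A w) /\
    (forall w : seq S,
       mh_halts_within A w
         ((t (size w) * ((4 * c + 3) * size w + 4 * c + 4)) %/ 2)).
Proof.
(* Writing the number of tracks as a successor provides a first track [ord0] and a last track
   [ord_max]. *)
case: c => // c _ card_work space halts LE.
have [enc [enc_inj enc_blank]] := exists_bit_encoding (tm_blank M) card_work.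
exists (automaton enc); split=> w; last exact: automaton_halts_within.
rewrite LE; split; first exact: tm_accepts_mh_accepts.
exact: mh_accepts_tm_accepts.
Qed.
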